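(* For all integers $r\geq0$, $s\geq0$, $n\geq0$ and every partition $\lambda\vdash n+rs$, the rational number $$C_{\lambda,r}^{(s)}=\frac{n!\,e_{r}\big((\lambda^{>s})_{s}\big)}{\prod_{i\geq1}(i!)^{m_{i}(\lambda)}m_{i}(\lambda)!}$$ is an integer.
   Context: A partition $\lambda$ is a finite weakly decreasing sequence of positive integers $a_1,\dots,a_L$ (the empty partition is allowed), $|\lambda|=\sum_l a_l$, and $\lambda\vdash N$ means $|\lambda|=N$. For $i\geq1$ the multiplicity $m_i(\lambda)$ is the number of indices $l$ with $a_l=i$. For an integer $s\geq0$, $\lambda^{>s}$ is the partition obtained from $\lambda$ by deleting all parts $a_l\leq s$. For a non-negative integer $a$, $(a)_s=\prod_{\upsilon=0}^{s-1}(a-\upsilon)$ (falling factorial, $(a)_0=1$). For a partition $\mu$, $(\mu)_s$ is the finite sequence obtained by replacing each part $a_l$ of $\mu$ by $(a_l)_s$. For $r\geq0$, $e_r$ of a finite sequence of numbers is the $r$th elementary symmetric function of its entries, with $e_0=1$ and $e_r=0$ if the sequence has fewer than $r$ entries. *)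

(* Defs.v *)
From mathcomp Require Import all_boot all_order all_algebra.
From mathcomp Require Import mpoly.

Set Implicit Arguments.
Unset Strict Implicit.
Unset Printing Implicit Defensive.

Import GRing.Theory.

Local Open Scope ring_scope.

Definition is_partition (la : seq nat) : bool :=
  sorted geq la && all (fun a => 0 < a)%N la.

Definition is_partition_of (N : nat) (la : seq nat) : bool :=
  is_partition la && (sumn la == N).

Definition multiplicity (la : seq nat) (i : nat) : nat := count_mem i la.

Definition parts_gt (s : nat) (la : seq nat) : seq nat :=
  [seq a <- la | (s < a)%N].

Definition ffact_parts (s : nat) (mu : seq nat) : seq nat :=
  [seq (a ^_ s)%N | a <- mu].

Definition elem_sym (R : comNzRingType) (r : nat) (x : seq R) : R :=
  (mesym (size x) R r).@[fun i : 'I_(size x) => x`_i].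

(* No part of la exceeds sumn la, so the product over 1 <= i <= sumn la has
   all the factors that differ from 1 in the product over all i >= 1. *)
Definition partition_denom (la : seq nat) : nat :=
  (\prod_(1 <= i < (sumn la).+1)
     (i`! ^ multiplicity la i * (multiplicity la i)`!))%N.

(* n is the integer such that la is a partition of n + r * s. *)
Definition integrality_coef (n r s : nat) (la : seq nat) : rat :=
  (n`!)%:R * elem_sym r [seq a%:R | a <- ffact_parts s (parts_gt s la)]
  / (partition_denom la)%:R.

(* Main.v *)
(* Expanding e_r by the distinct part sizes i, with k_i of the m_i parts equal
   to i selected, gives
     C = \sum_(k_i) n! / \prod_i (i!^(m_i - k_i) (m_i - k_i)! (i - s)!^k_i k_i!),
   where k_i <= m_i, \sum_i k_i = r, and k_i = 0 for i <= s. Each term counts the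
   partitions of an n-set into m_i - k_i blocks of size i of a first colour and
   k_i blocks of size i - s > 0 of a second colour. *)

Require Import Defs.
From mathcomp Require Import all_boot all_order all_algebra.
From mathcomp Require Import mpoly.
From mathcomp Require Import zify.

Set Implicit Arguments.
Unset Strict Implicit.
Unset Printing Implicit Defensive.

Import GRing.Theory.

Local Open Scope ring_scope.

(** Generating polynomial of the elementary symmetric functions. A semiring suffices, so it also
    lives over [nat], where divisibility is meaningful. *)
Definition sym_poly (R : comNzSemiRingType) (x : seq R) : {poly R} :=
  \prod_(a <- x) (1 + a%:P * 'X).

Lemma elem_sym_coef (R : comNzRingType) (r : nat) (x : seq R) :
  elem_sym r x = (sym_poly x)`_r.
Proof.
rewrite /sym_poly (big_nth 0) big_mkord /elem_sym /mesym.
under [in RHS]eq_bigr => i _ do rewrite addrC.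
(* Distributing the product gives one term per index set [J], of degree [#|J|]. *)
rewrite bigA_distr coef_sum raddf_sum big_mkcond /=; apply: eq_bigr => J _.
rewrite -big_mkcond /= big_split /= prodr_const -rmorph_prod /= coefCM coefXn.
rewrite eq_sym rmorph_prod /=; case: eqP => _; last by rewrite mulr0.
by rewrite mulr1; apply: eq_bigr => i _; rewrite mevalXU.
Qed.

Lemma coef_sym_poly_natr (R : comNzRingType) (r : nat) (x : seq nat) :
  (sym_poly [seq a%:R : R | a <- x])`_r = ((sym_poly x)`_r)%R%:R.
Proof.
rewrite -(coef_map (GRing.natmul 1 : {rmorphism nat -> R})); congr (nth 0 _ r).
rewrite /sym_poly big_map rmorph_prod; congr polyseq; apply: eq_bigr => a _.
by rewrite rmorphD rmorphM rmorph1 /= map_polyC map_polyX.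
Qed.

Lemma coef_linear_exp (R : comNzSemiRingType) (c : R) (m k : nat) :
  ((1 + c%:P * 'X) ^+ m)`_k = c ^+ k *+ 'C(m, k).
Proof.
rewrite exprDn coef_sum.
under eq_bigr => i _ do
  rewrite expr1n mul1r coefMn exprMn -rmorphXn /= coefCM coefXn.
case: (ltnP k m.+1) => [ltkm | ltmk].
  rewrite (bigD1 (Ordinal ltkm)) //= eqxx mulr1 big1 ?addr0 // => i neik.
  rewrite (_ : (k == i) = false) ?mulr0 ?mul0rn //.
  by apply/negbTE; rewrite eq_sym.
rewrite bin_small // mulr0n big1 // => i _.
by rewrite (_ : (k == i) = false) ?mulr0 ?mul0rn //; have := ltn_ord i; lia.
Qed.

(** The quotient counts partitions of a set into [k] blocks of size [b]. In the induction, choosing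
    the block of a fixed element supplies the new factor [k.+1]. *)
Lemma fact_exp_dvd (b k : nat) :
  (0 < b)%N -> (b`! ^ k * k`! %| (k * b)`!)%N.
Proof.
case: b => // b _; elim: k => [|k IHk] //.
have leb : (b.+1 <= k.+1 * b.+1)%N by rewrite leq_pmull.
have binE : 'C(k.+1 * b.+1, b.+1) = (k.+1 * 'C((k.+1 * b.+1).-1, b))%N.
  apply/eqP; rewrite -(eqn_pmul2l (ltn0Sn b)) -mul_bin_diag.
  by apply/eqP; lia.
rewrite -(bin_fact leb) binE (mulSn k b.+1) addKn expnS (factS k).
have -> : (b.+1`! * b.+1`! ^ k * (k.+1 * k`!)
           = k.+1 * (b.+1`! * (b.+1`! ^ k * k`!)))%N by lia.
by rewrite -mulnA dvdn_pmul2l // dvdn_mull // dvdn_pmul2l ?fact_gt0.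
Qed.

(* The binomial identity 'C(m, k) N_(s)^k N!^(m-k) (m-k)! ((N-s)!)^k k! = N!^m m!
   turns the quotient into the number of partitions of an (m N - k s)-set into
   m - k blocks of size N and k blocks of size N - s, these being coloured. *)
Lemma fact_exp_dvd_ffact (N s m k : nat) :
  (0 < N)%N -> (k <= m)%N -> (k = 0 \/ s < N)%N ->
  (N`! ^ m * m`! %| (m * N - k * s)`! * ((N ^_ s) ^ k * 'C(m, k)))%N.
Proof.
move=> N_gt0 lekm [-> | ltsN].
  by rewrite mul0n subn0 expn0 bin0 !muln1 fact_exp_dvd.
have qE : (m * N - k * s = (m - k) * N + k * (N - s))%N by nia.
have leq : ((m - k) * N <= m * N - k * s)%N by rewrite qE leq_addr.
rewrite -(bin_fact leq) {2}qE addKn.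
have -> : (N`! ^ m * m`! = N`! ^ (m - k) * (m - k)`! * ((N - s)`! ^ k * k`!) *
                           ((N ^_ s) ^ k * 'C(m, k)))%N.
  rewrite -{1}(subnK lekm) expnD -{2}(ffact_fact (ltnW ltsN)) expnMn.
  by rewrite -(bin_fact lekm); lia.
rewrite dvdn_mul // dvdn_mull // dvdn_mul ?fact_exp_dvd //.
by rewrite subn_gt0.
Qed.

Section Blocks.

Variables (s : nat) (m : nat -> nat).

(** Grouping by part size prepares an induction on the largest size; the default 0 turns the factors
    with [i <= s] into 1, which deletes those parts. *)
Definition block_poly (N : nat) : {poly nat} :=
  \prod_(1 <= i < N.+1)
     (1 + (if s < i then i ^_ s else 0)%N%:P * 'X) ^+ m i.

Lemma coef_block_polyS (N r : nat) :
  ((block_poly N.+1)`_r)%R =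
  (\sum_(k < r.+1) (if s < N.+1 then N.+1 ^_ s else 0) ^ k * 'C(m N.+1, k)
     * ((block_poly N)`_(r - k)%N)%R)%N.
Proof.
rewrite /block_poly big_nat_recr //= mulrC coefM.
by apply: eq_bigr => k _; rewrite coef_linear_exp -mulr_natr natn natrXE.
Qed.

(** Separates the terms that [fact_exp_dvd_ffact] handles from those that vanish. When [N.+1 <= s],
    only [k = 0] survives, as [0 ^ 0 = 1]. *)
Lemma block_poly_term (N r k : nat) (c := ((block_poly N)`_(r - k)%N)%R) :
  ((if s < N.+1 then N.+1 ^_ s else 0) ^ k * 'C(m N.+1, k) * c = 0)%N \/
  [/\ (k <= m N.+1)%N, (k = 0 \/ s < N.+1)%N, c <> 0%N &
  ((if s < N.+1 then N.+1 ^_ s else 0) ^ k * 'C(m N.+1, k) * c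
    = (N.+1 ^_ s) ^ k * 'C(m N.+1, k) * c)%N].
Proof.
case: (leqP k (m N.+1)) => [lekm | ltmk]; last first.
  by left; rewrite bin_small // muln0.
case: (c =P 0%N) => [-> | nzc]; first by left; rewrite muln0.
case: k @c lekm nzc => [|k] c lekm nzc; first by right; split=> //; left.
case: (ltnP s N.+1) => ltsN; last by left; rewrite exp0n.
by right; split=> //; right.
Qed.

(** Each of the [r] selected parts exceeds [s]. This bound keeps the truncated subtractions below
    exact. *)
Lemma coef_block_poly_neq0_leq (N r : nat) :
  ((block_poly N)`_r)%R <> 0%N -> (r * s <= \sum_(1 <= i < N.+1) m i * i)%N.
Proof.
elim: N r => [|N IHN] r.
  by rewrite /block_poly !big_geq // coef1; case: r.
rewrite coef_block_polyS big_nat_recr //= => /eqP.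
rewrite sum_nat_eq0 negb_forall => /existsP[k].
rewrite /= => /eqP nz; have lekr : (k <= r)%N by have := ltn_ord k; lia.
case: (block_poly_term N r k) => [// | [lekm ltsN nzc _]].
have := IHN _ nzc; rewrite mulnBl.
by case: ltsN => [-> | ltsN]; nia.
Qed.

Lemma block_poly_dvd (N r n : nat) :
  (n + r * s = \sum_(1 <= i < N.+1) m i * i)%N ->
  (\prod_(1 <= i < N.+1) (i`! ^ m i * (m i)`!) %| n`! * ((block_poly N)`_r)%R)%N.
Proof.
elim: N r n => [|N IHN] r n.
  by move=> _; rewrite big_geq // dvd1n.
rewrite coef_block_polyS !(big_nat_recr _ _ _ (ltn0Sn N)) /= => defn.
rewrite big_distrr /=; apply: dvdn_sum => k _.
have lekr : (k <= r)%N by have := ltn_ord k; lia.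
case: (block_poly_term N r k) => [-> | [lekm ltsN nzc ->]].
  by rewrite muln0.
(* [q] elements lie in the blocks coming from parts [N.+1]; the factor ['C(n, q)] chooses them, and
   induction treats the other [n - q]. *)
set q := (m N.+1 * N.+1 - k * s)%N.
have leks : (k * s <= m N.+1 * N.+1)%N.
  by case: ltsN => [-> // | ltsN]; apply: leq_mul => //; exact: ltnW.
have lers := coef_block_poly_neq0_leq nzc; rewrite mulnBl in lers.
have leksr : (k * s <= r * s)%N by rewrite leq_mul.
have leqn : (q <= n)%N by rewrite /q; lia.
have /IHN dvd_c : (n - q + (r - k) * s = \sum_(1 <= i < N.+1) m i * i)%N.
  by rewrite mulnBl /q; lia.
rewrite -(bin_fact leqn).
have -> : forall a b c d e, (a * (b * c) * (d * e) = a * ((c * e) * (b * d)))%N.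
  by move=> *; lia.
by rewrite dvdn_mull // dvdn_mul // fact_exp_dvd_ffact.
Qed.

End Blocks.

(** Exchanging the two big operators groups equal entries. A general [op] covers both the product
    [sym_poly] and the sum of the parts. *)
Lemma big_count_iter (R : Type) (idx : R) (op : Monoid.com_law idx)
    (N : nat) (la : seq nat) (F : nat -> R) :
  all (fun a => 0 < a <= N)%N la ->
  \big[op/idx]_(a <- la) F a
    = \big[op/idx]_(1 <= i < N.+1) iter (count_mem i la) (op (F i)) idx.
Proof.
move=> /allP rng.
under [RHS]eq_bigr => i _ do rewrite -big_const_seq.
rewrite (exchange_big_dep xpredT) //= !big_seq; apply: eq_bigr => a /rng rng_a.
under eq_bigl => i do rewrite eq_sym.
by rewrite big_nat1_eq ltnS rng_a.
Qed.

Lemma sym_poly_count (R : comNzSemiRingType) (N : nat) (la : seq nat)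
    (P : pred nat) (f : nat -> R) :
  all (fun a => 0 < a <= N)%N la ->
  sym_poly [seq f a | a <- la & P a]
    = \prod_(1 <= i < N.+1)
        (1 + (if P i then f i else 0)%:P * 'X) ^+ count_mem i la.
Proof.
move=> rng; rewrite /sym_poly big_map big_filter big_mkcond.
rewrite (big_count_iter _ _ rng); apply: eq_bigr => i _; rewrite iter_mulr_1.
by case: (P i); rewrite // mul0r addr0.
Qed.

Theorem corollary9 (r s n : nat) (la : seq nat)
  (hla : is_partition_of (n + r * s)%N la) :
  integrality_coef n r s la \is a Num.int.
Proof.
case/andP: hla => /andP[_ /allP la_gt0] /eqP sumla.
rewrite /integrality_coef elem_sym_coef coef_sym_poly_natr -natrM.
set N := sumn la.
have rng : all (fun a => 0 < a <= N)%N la.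
  apply/allP => a a_la; rewrite la_gt0 //= /N sumnE.
  by rewrite (big_rem a) //= leq_addr.
have -> : sym_poly (ffact_parts s (parts_gt s la)) =
          block_poly s (multiplicity la) N by exact: sym_poly_count.
rewrite -Num.Theory.natf_div ?Num.Theory.natr_int //.
apply: block_poly_dvd; rewrite -sumla -/N {1}/N sumnE (big_count_iter _ _ rng).
by apply: eq_bigr => i _; rewrite iter_addn_0 mulnC.
Qed.
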